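(* Assume that $H$ is closed concave, symmetric, and has $\operatorname{dom}H=\Delta_k$, and let $L(\alpha,i)=-\alpha_i+(-H)^*(\alpha)$ for $\alpha\in\mathbb{R}^k$, $i\in\{1,\ldots,k\}$. Additionally assume that (a) $H$ is strictly concave, and $\inf_\alpha\sum_{i=1}^k\pi_iL(\alpha,i)$ is attained for all $\pi\in\Delta_k$, or (b) $H$ is uniformly concave. Then $L$ is classification calibrated.
   Context: $\Delta_k=\{p\in\mathbb{R}^k_+ : \mathbf{1}^Tp=1\}$. A concave $H$ is closed if $-H$ has closed epigraph; $\operatorname{dom}H=\{H>-\infty\}$; symmetric means invariant under permutations of coordinates. $(-H)^*(\alpha)=\sup_{\pi\in\Delta_k}\{\alpha^T\pi+H(\pi)\}$. A convex function $f:\mathbb{R}^k\to\mathbb{R}\cup\{+\infty\}$ is $(\lambda,\kappa,\|\cdot\|)$-uniformly convex over $C\subset\mathbb{R}^k$ if it is closed and for all $t\in[0,1]$, $x_1,x_2\in C$, $$f(tx_1+(1-t)x_2)\le tf(x_1)+(1-t)f(x_2)-\frac\lambda2t(1-t)\|x_1-x_2\|^\kappa\big[(1-t)^{\kappa-1}+t^{\kappa-1}\big].$$ $f$ is uniformly convex on $C$ if $\operatorname{dom}f\supset C$ and this holds for some $\lambda>0$, norm $\|\cdot\|$ and $\kappa<\infty$; $H$ is uniformly concave (here, on $\Delta_k$) if $-H$ is uniformly convex. $L$ is classification calibrated (for the zero-one loss) if for any $\pi\in\Delta_k$ and $i^*$ such that $\pi_{i^*}<\max_j\pi_j$, $$\inf_{\alpha\in\mathbb{R}^k}\sum_{i=1}^k\pi_iL(\alpha,i)<\inf_{\alpha\in\mathbb{R}^k}\Big\{\sum_{i=1}^k\pi_iL(\alpha,i)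 : \alpha_{i^*}\ge\max_j\alpha_j\Big\}.$$ *)

(* Defs.v *)
(* MathComp-Analysis, over an arbitrary [R : realType]; vectors of R^k are
   row vectors ['rV[R]_k] and the classes are the elements of ['I_k]. *)
From HB Require Import structures.
From mathcomp Require Export all_boot all_order all_algebra all_fingroup.
From mathcomp Require Export all_classical all_reals all_analysis.

Set Implicit Arguments.
Unset Strict Implicit.
Unset Printing Implicit Defensive.

Import Order.TTheory GRing.Theory Num.Theory.
Import numFieldNormedType.Exports.

Local Open Scope classical_set_scope.
Local Open Scope ring_scope.
Local Open Scope ereal_scope.

Definition prob_simplex (R : realType) (k : nat) : set 'rV[R]_k :=
  [set p | (forall i, (0 <= p ord0 i)%R) /\ (\sum_(i < k) p ord0 i = 1)%R].

Definition epigraph (R : realType) (k : nat) (f : 'rV[R]_k -> \bar R) :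
    set ('rV[R]_k * R) :=
  [set z | f z.1 <= z.2%:E].

Definition closed_fun (R : realType) (k : nat) (f : 'rV[R]_k -> \bar R) : Prop :=
  closed (epigraph f).

(* A convex function takes its values in R \cup {+oo}; the convention
   0 * +oo = 0 makes the inequality trivial at t = 0 and t = 1. *)
Definition convex_fun (R : realType) (k : nat) (f : 'rV[R]_k -> \bar R) : Prop :=
  (forall x, f x != -oo) /\
  (forall (t : R) (x y : 'rV[R]_k), (0 <= t <= 1)%R ->
     f (t *: x + (1 - t) *: y)%R <= t%:E * f x + (1 - t)%:E * f y).

Definition convex_dom (R : realType) (k : nat) (f : 'rV[R]_k -> \bar R) :
    set 'rV[R]_k :=
  [set x | f x < +oo].

Definition closed_concave (R : realType) (k : nat) (H : 'rV[R]_k -> \bar R) : Prop :=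
  convex_fun (\- H) /\ closed_fun (\- H).

Definition concave_dom (R : realType) (k : nat) (H : 'rV[R]_k -> \bar R) :
    set 'rV[R]_k :=
  [set x | -oo < H x].

Definition strictly_concave (R : realType) (k : nat) (H : 'rV[R]_k -> \bar R) : Prop :=
  forall (t : R) (x y : 'rV[R]_k), (0 < t < 1)%R ->
    concave_dom H x -> concave_dom H y -> x != y ->
    t%:E * H x + (1 - t)%:E * H y < H (t *: x + (1 - t) *: y)%R.

Definition symmetric_fun (R : realType) (k : nat) (H : 'rV[R]_k -> \bar R) : Prop :=
  forall (s : 'S_k) (x : 'rV[R]_k), H (col_perm s x) = H x.

Definition is_norm (R : realType) (k : nat) (N : 'rV[R]_k -> R) : Prop :=
  [/\ forall x y, (N (x + y) <= N x + N y)%R,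
      forall (a : R) x, N (a *: x)%R = (`|a| * N x)%R
    & forall x, N x = 0%R -> x = 0%R].

Definition uniformly_convex_with (R : realType) (k : nat) (lambda kappa : R)
    (N : 'rV[R]_k -> R) (f : 'rV[R]_k -> \bar R) (C : set 'rV[R]_k) : Prop :=
  [/\ convex_fun f, closed_fun f
    & forall (t : R) (x1 x2 : 'rV[R]_k), (0 <= t <= 1)%R -> C x1 -> C x2 ->
        f (t *: x1 + (1 - t) *: x2)%R <=
          t%:E * f x1 + (1 - t)%:E * f x2
          - (lambda / 2 * t * (1 - t) * (N (x1 - x2) `^ kappa)
             * ((1 - t) `^ (kappa - 1) + t `^ (kappa - 1)))%R%:E].

Definition uniformly_convex (R : realType) (k : nat)
    (f : 'rV[R]_k -> \bar R) (C : set 'rV[R]_k) : Prop :=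
  C `<=` convex_dom f /\
  exists (lambda kappa : R) (N : 'rV[R]_k -> R),
    [/\ (0 < lambda)%R, is_norm N & uniformly_convex_with lambda kappa N f C].

Definition uniformly_concave (R : realType) (k : nat)
    (H : 'rV[R]_k -> \bar R) : Prop :=
  uniformly_convex (\- H) (@prob_simplex R k).

(* The conjugate (-H)^* of an H that is -oo outside the simplex *)
Definition neg_conjugate (R : realType) (k : nat) (H : 'rV[R]_k -> \bar R)
    (alpha : 'rV[R]_k) : \bar R :=
  ereal_sup [set (\sum_(i < k) alpha ord0 i * pi ord0 i)%R%:E + H pi
            | pi in @prob_simplex R k].

Definition entropy_loss (R : realType) (k : nat) (H : 'rV[R]_k -> \bar R)
    (alpha : 'rV[R]_k) (i : 'I_k) : \bar R :=
  (- alpha ord0 i)%R%:E + neg_conjugate H alpha.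

Definition cond_risk (R : realType) (k : nat) (L : 'rV[R]_k -> 'I_k -> \bar R)
    (pi alpha : 'rV[R]_k) : \bar R :=
  \sum_(i < k) (pi ord0 i)%:E * L alpha i.

Definition cond_risk_attained (R : realType) (k : nat)
    (L : 'rV[R]_k -> 'I_k -> \bar R) (pi : 'rV[R]_k) : Prop :=
  exists alpha0, cond_risk L pi alpha0 =
    ereal_inf [set cond_risk L pi alpha | alpha in [set: 'rV[R]_k]].

(* max_j x_j, taken in \bar R so that -oo is the neutral element of the
   iterated maximum *)
Definition max_coord (R : realType) (k : nat) (x : 'rV[R]_k) : \bar R :=
  \big[maxe/-oo]_(j < k) (x ord0 j)%:E.

Definition classification_calibrated (R : realType) (k : nat)
    (L : 'rV[R]_k -> 'I_k -> \bar R) : Prop :=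
  forall (pi : 'rV[R]_k) (istar : 'I_k),
    @prob_simplex R k pi -> (pi ord0 istar)%:E < max_coord pi ->
    ereal_inf [set cond_risk L pi alpha | alpha in [set: 'rV[R]_k]] <
    ereal_inf [set cond_risk L pi alpha
              | alpha in [set a : 'rV[R]_k | max_coord a <= (a ord0 istar)%:E]].

(* Main.v *)
Require Import Defs.
From mathcomp Require Import ring lra.

(** Write [F] for the conjugate of [-H]. Since the coordinates of [p] sum to
one, the conditional risk is [F alpha - <alpha, p>], and the theorem compares
two bounds on it. Let [j] be a class with [p i < p j], let [q] be [p] with the
coordinates [i] and [j] exchanged, and let [m] be the midpoint of [p] and [q].

If [alpha] is largest at [i], the exchange can only increase
[<alpha, p>], so [<alpha, p> <= <alpha, m>] ([dotr_swap_midpoint]), and the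
Fenchel-Young inequality at [m] shows that the risk of [alpha] is at least
[H m]. By symmetry [H q = H p], so strict concavity gives [H p < H m]; uniform
concavity implies it ([uniformly_concave_strictly_concave]). The constrained
infimum thus exceeds [H p] by a fixed amount.

The unconstrained infimum is at most [H p] ([near_conjugate]). This is the
Fenchel-Moreau inequality for the closed convex function [-H] at a point of its
domain: it needs affine minorants of [-H] which almost touch it at [p], and
[p] may lie on the boundary of the simplex, where subgradients need not exist.
They are obtained by penalisation ([approximate_subgradient]): for large [n], an
approximate minimiser [p'] of [h + n |. - p|^2] is close to [p], hence [h p'] is
almost at least [h p] by lower semicontinuity, and the first-order optimality
condition at [p'] says that [2 n (p - p')] is an approximate subgradient
of [h] there. *)

Set Implicit Arguments.
Unset Strict Implicit.
Unset Printing Implicit Defensive.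

Import Order.TTheory GRing.Theory Num.Theory.
Import numFieldNormedType.Exports.

Local Open Scope classical_set_scope.
Local Open Scope ring_scope.

(** * Approximate subgradients of lower semicontinuous convex functions *)

Definition dotr (R : realType) (k : nat) (x y : 'rV[R]_k) : R :=
  \sum_(i < k) x ord0 i * y ord0 i.

Lemma dotr_ge0 (R : realType) (k : nat) (x : 'rV[R]_k) : 0 <= dotr x x.
Proof. by apply: sumr_ge0 => i _; rewrite -expr2 sqr_ge0. Qed.

Lemma coord_sqr_le_dotr (R : realType) (k : nat) (x : 'rV[R]_k) (i : 'I_k) :
  x ord0 i ^+ 2 <= dotr x x.
Proof.
rewrite /dotr (bigD1 i) //= -expr2 lerDl.
by apply: sumr_ge0 => j _; rewrite -expr2 sqr_ge0.
Qed.

Lemma dotrZ (R : realType) (k : nat) (t : R) (x : 'rV[R]_k) :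
  dotr (t *: x) (t *: x) = t ^+ 2 * dotr x x.
Proof. by rewrite /dotr mulr_sumr; apply: eq_bigr => i _; rewrite !mxE; ring. Qed.

Lemma dotr_segment (R : realType) (k : nat) (t : R) (p q c : 'rV[R]_k) :
  dotr (t *: q + (1 - t) *: p - c) (t *: q + (1 - t) *: p - c) =
  dotr (p - c) (p - c) + 2 * t * dotr (p - c) (q - p)
  + t ^+ 2 * dotr (q - p) (q - p).
Proof.
rewrite /dotr !mulr_sumr -!big_split /=.
by apply: eq_bigr => i _; rewrite !mxE; ring.
Qed.

(** A point [q] far from [c] can be pulled along the segment to [c] by a factor
[s] that depends only on [r] and the diameter of [C], until it enters the
neighbourhood where [h > h c - e]; convexity then bounds [h q] from below by
[h c - e / s]. *)
Lemma lsc_convex_bounded_below (R : realType) (k : nat) (C : set 'rV[R]_k)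
    (h : 'rV[R]_k -> R) (D r e : R) (c : 'rV[R]_k) :
  (forall t p q, 0 <= t <= 1 -> C p -> C q -> C (t *: p + (1 - t) *: q)) ->
  (forall p q, C p -> C q -> dotr (p - q) (p - q) <= D) ->
  (forall t p q, 0 <= t <= 1 -> C p -> C q ->
     h (t *: p + (1 - t) *: q) <= t * h p + (1 - t) * h q) ->
  C c -> 0 < r -> 0 < e ->
  (forall q, C q -> dotr (q - c) (q - c) < r -> h c - e < h q) ->
  exists2 M : R, 0 < M & forall q, C q -> h c - M <= h q.
Proof.
move=> Ccvx CD hcvx Cc r0 e0 hr.
have D0 : 0 <= D by apply: le_trans (CD _ _ Cc Cc); exact: dotr_ge0.
pose s := r / (r + D + 1).
have den0 : 0 < r + D + 1 by lra.
have s0 : 0 < s by rewrite divr_gt0.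
have s1 : s <= 1 by rewrite ler_pdivrMr//; lra.
have sD : s * D < r.
  rewrite /s mulrAC ltr_pdivrMr// ltr_pM2l//; lra.
exists (e / s); first by rewrite divr_gt0.
move=> q Cq.
have s01 : 0 <= s <= 1 by rewrite (ltW s0).
have := hr _ (Ccvx _ _ _ s01 Cq Cc).
have -> : s *: q + (1 - s) *: c - c = s *: (q - c).
  by apply/matrixP => i j; rewrite !mxE; ring.
rewrite dotrZ.
have sDs : s ^+ 2 * dotr (q - c) (q - c) < r.
  have := CD _ _ Cq Cc; have := dotr_ge0 (q - c) => d0 dD.
  apply: le_lt_trans sD; rewrite expr2 -mulrA ler_pM2l//.
  apply: le_trans dD; rewrite ler_piMl//.
move=> /(_ sDs) h1.
have h2 := hcvx _ _ _ s01 Cq Cc.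
rewrite -(ler_pM2l s0) mulrBr mulrCA divff ?gt_eqF// mulr1; nra.
Qed.

(** The slope comes from an approximate minimiser [p] of the penalised function
[g q = h q + n |q - c|^2]: the infimum of [g] is finite because [h] is bounded
below, and minimality up to [delta] perturbs the first-order condition at [p] by
an amount that a suitable step [t] makes small. *)
Lemma approximate_subgradient (R : realType) (k : nat) (C : set 'rV[R]_k)
    (h : 'rV[R]_k -> R) (D : R) (c : 'rV[R]_k) :
  (forall t p q, 0 <= t <= 1 -> C p -> C q -> C (t *: p + (1 - t) *: q)) ->
  (forall p q, C p -> C q -> dotr (p - q) (p - q) <= D) ->
  (forall t p q, 0 <= t <= 1 -> C p -> C q ->
     h (t *: p + (1 - t) *: q) <= t * h p + (1 - t) * h q) ->
  C c ->
  (forall e, 0 < e -> exists2 r : R, 0 < r &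
     forall q, C q -> dotr (q - c) (q - c) < r -> h c - e < h q) ->
  forall e, 0 < e -> exists alpha : 'rV[R]_k,
    forall q, C q -> dotr alpha q - h q <= dotr alpha c - h c + e.
Proof.
move=> Ccvx CD hcvx Cc hlsc e e0.
have D0 : 0 <= D by apply: le_trans (CD _ _ Cc Cc); exact: dotr_ge0.
have e20 : 0 < e / 2 by lra.
have [r r0 hr] := hlsc _ e20.
have [M M0 hM] := lsc_convex_bounded_below Ccvx CD hcvx Cc r0 e20 hr.
(* [n] is chosen so that [n |p - c|^2 <= M + delta] with [delta <= 1] forces
   [|p - c|^2 < r]. *)
pose n := (M + 2) / r.
have n0 : 0 < n by rewrite divr_gt0//; lra.
have nr : n * r = M + 2 by rewrite /n divfK ?gt_eqF.
(* Comparing [p] with the point at parameter [t] on the segment to [q], and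
   dividing by [t], leaves an error [delta / t + n t D]. With
   [delta = n t^2] this is [n t (1 + D)]; the three summands of [b] make it at
   most [e / 2] and ensure [t <= 1] and [n t <= 1]. *)
pose b := 2 * n * (1 + D) + e + n * e.
have ne0 : 0 < n * e by rewrite mulr_gt0.
have nD0 : 0 < n * (1 + D) by rewrite mulr_gt0//; lra.
have b0 : 0 < b by rewrite /b; lra.
pose t := e / b.
have t0 : 0 < t by rewrite divr_gt0.
have tb : t * b = e by rewrite /t divfK ?gt_eqF.
have t1 : t <= 1 by rewrite ler_pdivrMr// mul1r /b; lra.
have tn1 : n * t <= 1.
  by rewrite mulrA ler_pdivrMr// mul1r /b; lra.
have tnD : n * t * (1 + D) <= e / 2.
  have : 0 < t * (e + n * e) by rewrite mulr_gt0//; lra.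
  by rewrite -[in X in _ -> _ <= X]tb /b; lra.
pose delta := n * t ^+ 2.
have delta0 : 0 < delta by rewrite mulr_gt0// exprn_gt0.
have delta1 : delta <= 1.
  by apply: le_trans t1; rewrite /delta expr2 mulrA ler_piMl// ltW.
pose g q := h q + n * dotr (q - c) (q - c).
have gC : has_inf (g @` C).
  split; first by exists (g c), c.
  exists (h c - M) => _ [q Cq <-].
  apply: le_trans (hM _ Cq) _.
  by rewrite lerDl mulr_ge0 ?dotr_ge0// ltW.
have [_ [p Cp <-] pinf] := inf_adherent delta0 gC.
have gp q : C q -> g p <= g q + delta.
  move=> Cq; apply/ltW/(lt_le_trans pinf); rewrite lerD2r.
  by apply: ge_inf; [exact: gC.2|exists q].
have dpc : n * dotr (p - c) (p - c) <= M + delta.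
  have := gp _ Cc; have := hM _ Cp.
  rewrite /g subrr.
  have -> : dotr 0 (0 : 'rV[R]_k) = 0.
    by rewrite /dotr big1// => i _; rewrite mxE mul0r.
  lra.
have pr : dotr (p - c) (p - c) < r.
  by rewrite -(ltr_pM2l n0) nr; lra.
have hp := hr _ Cp pr.
(* This is minus the gradient at [p] of the penalty [n |. - c|^2]. *)
exists ((2 * n) *: (c - p)) => q Cq.
have t01 : 0 <= t <= 1 by rewrite t1 ltW.
have := gp _ (Ccvx _ _ _ t01 Cq Cp).
rewrite /g dotr_segment.
have := hcvx _ _ _ t01 Cq Cp.
have := CD _ _ Cq Cp; have := dotr_ge0 (q - p).
have := dotr_ge0 (p - c).
have -> : dotr (2 * n *: (c - p)) q =
   dotr (2 * n *: (c - p)) c - 2 * n * dotr (p - c) (q - p)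
   - 2 * n * dotr (p - c) (p - c).
  rewrite /dotr !mulr_sumr -!sumrB.
  by apply: eq_bigr => i _; rewrite !mxE; ring.
set u := dotr (p - c) (p - c); set v := dotr (p - c) (q - p).
set w := dotr (q - p) (q - p).
move=> u0 w0 wD hcv hmin.
have tw : n * t ^+ 2 * w <= n * t ^+ 2 * D by rewrite ler_wpM2l// ltW.
have nu : 0 <= n * u by rewrite mulr_ge0// ltW.
suff : h p - h q - 2 * n * v <= e / 2 by lra.
apply: le_trans tnD; rewrite -(ler_pM2l t0).
rewrite /delta in hmin; lra.
Qed.

(** * The simplex, closed functions and uniform concavity *)

Lemma prob_simplex_convex (R : realType) (k : nat) (t : R) (p q : 'rV[R]_k) :
  0 <= t <= 1 -> prob_simplex p -> prob_simplex q ->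
  prob_simplex (t *: p + (1 - t) *: q).
Proof.
move=> /andP[t0 t1] [p0 p1] [q0 q1]; split=> [i|].
  by rewrite !mxE addr_ge0// mulr_ge0// subr_ge0.
under eq_bigr do rewrite !mxE.
by rewrite big_split -!mulr_sumr p1 q1 /=; ring.
Qed.

Lemma prob_simplex_diameter (R : realType) (k : nat) (p q : 'rV[R]_k) :
  prob_simplex p -> prob_simplex q -> dotr (p - q) (p - q) <= 2.
Proof.
move=> [p0 p1] [q0 q1].
have le1 (x : 'rV[R]_k) i : (forall i, 0 <= x ord0 i) ->
    \sum_(i < k) x ord0 i = 1 -> x ord0 i <= 1.
  by move=> x0 <-; rewrite (bigD1 i)//= lerDl sumr_ge0.
have -> : 2 = \sum_(i < k) (p ord0 i + q ord0 i) :> R.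
  by rewrite big_split /= p1 q1; ring.
apply: ler_sum => i _; rewrite !mxE.
have := p0 i; have := q0 i; have := le1 p i p0 p1; have := le1 q i q0 q1.
by move: (p _ _) (q _ _) => a b *; nra.
Qed.

Lemma epigraph_closed_lsc (R : realType) (k : nat) (f : 'rV[R]_k -> \bar R)
    (c : 'rV[R]_k) (y : R) :
  closed_fun f -> (y%:E < f c)%E ->
  exists2 r : R, 0 < r &
    forall q, dotr (q - c) (q - c) < r -> (y%:E < f q)%E.
Proof.
move=> fcl yfc.
have : nbhs (c, y) (~` epigraph f).
  apply: open_nbhs_nbhs; split; first exact: closed_openC.
  by rewrite /epigraph /= => h; move: (le_lt_trans h yfc); rewrite ltxx.
case=> -[A B] /= [nA nB] AB.
have /nbhs_ballP[e /= e0 eA] := nA.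
exists (e ^+ 2) => [|q qc]; first exact: exprn_gt0.
rewrite ltNge; apply/negP => fqy.
suff Aq : A q by apply: (AB (q, y)) => //; split => //=; exact: nbhs_singleton.
apply: eA; split=> // i j; rewrite (ord1 i) /ball /= distrC.
rewrite -(ltr_pXn2r (ltn0Sn 1)) ?nnegrE ?(ltW e0)// real_normK ?num_real//.
apply: le_lt_trans qc.
by have := coord_sqr_le_dotr (q - c) j; rewrite !mxE.
Qed.

(** For [0 < t < 1] and [x <> y] the modulus of uniform convexity is positive for
every real [kappa], because [N (x - y) > 0] and real powers of positive numbers
are positive. *)
Lemma uniformly_concave_strictly_concave (R : realType) (k : nat)
    (H : 'rV[R]_k -> \bar R) :
  concave_dom H = @prob_simplex R k -> uniformly_concave H ->
  strictly_concave H.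
Proof.
move=> Hdom [_ [lambda [kappa [N [lambda0 [Nadd NZ N0]]]]]].
case=> -[Hpoo _] _ Huc t x y /andP[t0 t1] Hx Hy xy.
have N00 : N 0 = 0 by rewrite -(scale0r 0) NZ normr0 mul0r.
have Npos z : z != 0 -> 0 < N z.
  move=> z0; rewrite lt_neqAle eq_sym; apply/andP; split.
    by apply: contra z0 => /eqP /N0 ->.
  have := Nadd z (- z); rewrite subrr N00.
  by rewrite -(scaleN1r z) NZ normrN normr1 mul1r; lra.
have Nxy : 0 < N (x - y) by rewrite Npos// subr_eq0.
have t01 : 0 <= t <= 1 by rewrite !ltW.
rewrite -Hdom in Huc; have := Huc t x y t01 Hx Hy.
set m := _ * (_ + _).
have m0 : 0 < m.
  have t1' : 0 < 1 - t by lra.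
  by rewrite /m !(mulr_gt0, t1', divr_gt0, powR_gt0)// addr_gt0 ?powR_gt0.
move: Hx Hy (Hpoo x) (Hpoo y) (Hpoo (t *: x + (1 - t) *: y)).
rewrite /concave_dom /=.
case: (H x) => [a| |] //=; case: (H y) => [b| |] //= _ _ _ _.
case: (H (_ + _)) => [d| |] //= _; rewrite ?ltry//.
by rewrite -!EFinM -!EFinD lee_fin lte_fin; lra.
Qed.

(** * The conjugate of the entropy and the conditional risk *)

Lemma concave_dom_fineK (R : realType) (k : nat) (H : 'rV[R]_k -> \bar R)
    (p : 'rV[R]_k) :
  convex_fun (\- H)%E -> concave_dom H p -> (fine (H p))%:E = H p.
Proof.
move=> [Hoo _] Hp; apply: fineK; rewrite fin_numE.
by move: Hp (Hoo p); rewrite /concave_dom /=; case: (H p).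
Qed.

Lemma fenchel_young (R : realType) (k : nat) (H : 'rV[R]_k -> \bar R)
    (alpha p : 'rV[R]_k) :
  prob_simplex p -> ((dotr alpha p)%:E + H p <= neg_conjugate H alpha)%E.
Proof. by move=> Dp; apply: ereal_sup_ubound; exists p. Qed.

(** The half of Fenchel-Moreau duality that needs closedness: the Fenchel-Young
inequality at [p] is tight up to [e]. *)
Lemma near_conjugate (R : realType) (k : nat) (H : 'rV[R]_k -> \bar R)
    (p : 'rV[R]_k) (e : R) :
  closed_concave H -> concave_dom H = @prob_simplex R k ->
  prob_simplex p -> 0 < e ->
  exists alpha, (neg_conjugate H alpha <=
    (dotr alpha p + fine (H p) + e)%:E)%E.
Proof.
move=> [Hcvx Hcl] Hdom Dp e0.
have HE q : prob_simplex q -> H q = (fine (H q))%:E.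
  by move=> Dq; rewrite concave_dom_fineK// Hdom.
have [t q r|r r0|alpha ha] := @approximate_subgradient R k
    (@prob_simplex R k) (fun q => - fine (H q)) 2 p
    (@prob_simplex_convex R k) (@prob_simplex_diameter R k) _ Dp _ e e0.
- move=> t01 Dq Dr; have := Hcvx.2 t q r t01.
  rewrite (HE _ (prob_simplex_convex t01 Dq Dr)) (HE _ Dq) (HE _ Dr).
  by rewrite -!EFinN -!EFinM -EFinD lee_fin.
- have : ((- fine (H p) - r)%:E < (\- H) p)%E.
    by rewrite HE//= lte_fin; lra.
  move=> /(epigraph_closed_lsc Hcl) [d d0 hd].
  exists d => // q Dq /hd; by rewrite (HE _ Dq) -EFinN lte_fin.
exists alpha; apply: ge_ereal_sup => _ [q Dq <-].
by rewrite HE// -EFinD lee_fin; have := ha _ Dq; rewrite /dotr; lra.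
Qed.

(** The identity behind [risk = F alpha - <alpha, p>], for a real [c] in place of
the extended real [F alpha]; a real bound [c] on [F alpha] then bounds the risk,
as the weights [p i] are nonnegative. *)
Lemma cond_riskE (R : realType) (k : nat) (p alpha : 'rV[R]_k) (c : R) :
  prob_simplex p ->
  (\sum_(i < k) (p ord0 i)%:E * ((- alpha ord0 i)%:E + c%:E) =
   (c - dotr alpha p)%:E)%E.
Proof.
move=> [_ p1]; rewrite -[c in RHS]mul1r -p1 /dotr mulr_suml -sumrB -sumEFin.
by apply: eq_bigr => i _; rewrite -EFinD -EFinM; congr (_%:E); ring.
Qed.

Lemma cond_risk_ge (R : realType) (k : nat) (H : 'rV[R]_k -> \bar R)
    (p alpha : 'rV[R]_k) (c : R) :
  prob_simplex p -> (c%:E <= neg_conjugate H alpha)%E ->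
  ((c - dotr alpha p)%:E <= cond_risk (entropy_loss H) p alpha)%E.
Proof.
move=> Dp cF; rewrite -cond_riskE//; apply: lee_sum => i _.
by apply: lee_wpmul2l; [rewrite lee_fin; exact: Dp.1|exact: leeD2l].
Qed.

Lemma cond_risk_le (R : realType) (k : nat) (H : 'rV[R]_k -> \bar R)
    (p alpha : 'rV[R]_k) (c : R) :
  prob_simplex p -> (neg_conjugate H alpha <= c%:E)%E ->
  (cond_risk (entropy_loss H) p alpha <= (c - dotr alpha p)%:E)%E.
Proof.
move=> Dp cF; rewrite -cond_riskE//; apply: lee_sum => i _.
by apply: lee_wpmul2l; [rewrite lee_fin; exact: Dp.1|exact: leeD2l].
Qed.

(** Rearrangement: the difference of the two sides is
[(alpha i - alpha j) (p j - p i) / 2]. *)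
Lemma dotr_swap_midpoint (R : realType) (k : nat) (p alpha : 'rV[R]_k)
    (i j : 'I_k) :
  p ord0 i <= p ord0 j -> alpha ord0 j <= alpha ord0 i ->
  dotr alpha p <=
  dotr alpha (2^-1 *: p + (1 - 2^-1) *: col_perm (tperm i j) p).
Proof.
move=> pij aij; have [->|ij] := eqVneq i j.
  rewrite tperm1 col_perm1 -scalerDl.
  have -> : 2^-1 + (1 - 2^-1) = 1 :> R by lra.
  by rewrite scale1r.
rewrite -subr_ge0 /dotr -sumrB.
rewrite (bigD1 i)//= (bigD1 j) /= 1?eq_sym// big1 => [|l /andP[li lj]].
  have := mulr_ge0 (_ : 0 <= p ord0 j - p ord0 i)
                   (_ : 0 <= alpha ord0 i - alpha ord0 j).
  by rewrite !mxE tpermL tpermR !subr_ge0 => /(_ pij aij); lra.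
rewrite !mxE tpermD ?[_ == l]eq_sym//.
have -> : 1 - 2^-1 = 2^-1 :> R by lra.
by lra.
Qed.

Theorem proposition4 (R : realType) (k : nat) (H : 'rV[R]_k -> \bar R)
  (Hclosed : closed_concave H)
  (Hsym : symmetric_fun H)
  (Hdom : concave_dom H = @prob_simplex R k)
  (Hab : (strictly_concave H /\
          forall pi : 'rV[R]_k, @prob_simplex R k pi ->
            cond_risk_attained (entropy_loss H) pi)
         \/ uniformly_concave H) :
  classification_calibrated (entropy_loss H).
Proof.
have Hstrict : strictly_concave H.
  by case: Hab => [[]//|]; exact: uniformly_concave_strictly_concave.
move=> p i Dp pmax.
have [j pij] : exists j, p ord0 i < p ord0 j.
  apply: contrapT => /forallNP pj.
  move: pmax; rewrite ltNge => /negP; apply.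
  by apply: bigmax_le => [|j _]; rewrite ?leNye// lee_fin leNgt; apply/negP/pj.
pose q := col_perm (tperm i j) p.
have Hq : H q = H p by exact: Hsym.
have Dq : prob_simplex q.
  by move: Dp; rewrite -Hdom /concave_dom /= Hq.
have qp : p != q.
  apply/eqP => /matrixP /(_ ord0 i); rewrite mxE tpermL => pp.
  by rewrite pp ltxx in pij.
pose m := 2^-1 *: p + (1 - 2^-1) *: q.
have half01 : 0 < (2^-1 : R) < 1 by lra.
have Dm : prob_simplex m by apply: prob_simplex_convex => //; lra.
have HE r : prob_simplex r -> H r = (fine (H r))%:E.
  by move=> Dr; rewrite concave_dom_fineK ?Hdom//; exact: Hclosed.1.
have Hpm : fine (H p) < fine (H m).
  have := Hstrict _ p q half01; rewrite -/m Hdom => /(_ Dp Dq qp).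
  by rewrite Hq (HE _ Dp) (HE _ Dm) -!EFinM -EFinD lte_fin /=; lra.
have e0 : 0 < (fine (H m) - fine (H p)) / 2 by lra.
have [alpha ha] := near_conjugate Hclosed Hdom Dp e0.
apply: (@lt_le_trans _ _ (fine (H m))%:E).
  apply: (@le_lt_trans _ _ (cond_risk (entropy_loss H) p alpha)).
    by apply: ereal_inf_lbound; exists alpha.
  apply: (le_lt_trans (cond_risk_le Dp ha)).
  by rewrite lte_fin; lra.
apply: le_ereal_inf_tmp => _ [a amax <-].
have aij : a ord0 j <= a ord0 i.
  rewrite -lee_fin; apply: le_trans amax.
  exact: (le_bigmax _ (fun l => (a ord0 l)%:E)).
have hm := fenchel_young H a Dm; rewrite (HE _ Dm) -EFinD in hm.
apply: le_trans (cond_risk_ge Dp hm); rewrite lee_fin.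
by have := dotr_swap_midpoint (ltW pij) aij; rewrite -/q -/m; lra.
Qed.
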